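(* If $G$ is a finite soluble group and $H$ is a proper subgroup of $G$, then $\max(H,G)\le |G:H|-1$. In particular, every finite soluble transitive permutation group of degree $n\ge 2$ has at most $n-1$ maximal systems of imprimitivity.
   Context: For a finite group $G$ and a subgroup $H\le G$, $\max(H,G)$ denotes the number of maximal subgroups $M$ of $G$ with $H\le M$. A maximal system of imprimitivity of a transitive permutation group is a nontrivial $G$-invariant partition of the domain that is maximal among the $G$-invariant partitions other than the partition consisting of the whole domain as a single block. *)

(* Defs.v *)
From mathcomp Require Export all_boot all_fingroup all_solvable.
Set Implicit Arguments. Unset Strict Implicit. Unset Printing Implicit Defensive.

Definition max_over (gT : finGroupType) (H G : {set gT}) : {set {set gT}} :=
  [set M : {set gT} | maximal M G & H \subset M].

Section Systems.
Variable T : finType.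

Definition inv_partition (G : {set {perm T}}) (P : {set {set T}}) : bool :=
  partition P [set: T] &&
  [forall g in G, [forall B in P, [set g x | x in B] \in P]].

Definition trivial_partition (P : {set {set T}}) : bool :=
  (P == [set [set x] | x : T]) || (P == [set [set: T]]).

Definition refines (P Q : {set {set T}}) : bool :=
  [forall B in P, [exists C in Q, B \subset C]].

Definition max_system (G : {set {perm T}}) (P : {set {set T}}) : bool :=
  [&& inv_partition G P, ~~ trivial_partition P &
   [forall Q : {set {set T}},
     [&& inv_partition G Q, Q != [set [set: T]] & refines P Q] ==> (Q == P)]].

End Systems.

(* Main.v *)
Require Import Defs.
From mathcomp Require Import zify.
Set Implicit Arguments. Unset Strict Implicit. Unset Printing Implicit Defensive.

(* Induct on |G|, with N a minimal normal subgroup of G.  The maximal subgroups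
   over H that contain N are counted in G/N and number at most |G : NH| - 1.
   The others are complements of N in G containing H, so it suffices to bound
   their number by |G : NH| (|N| - 1).  Put C = C_G(N).  A complement K
   determines the normal subgroup D = K :&: C of G, a complement of N in C
   containing H :&: C; there are at most |C : N (H :&: C)| such D, by Schur's
   lemma applied to the homomorphisms C/N -> N that describe them.  If C = G
   this is the required bound.  Otherwise the complements sharing the same D
   are conjugate under N (Hall subgroups of L/D, with L/C minimal normal in
   G/C, of order prime to |N|), and those containing H are conjugate under
   C_N(H).  Either C_N(H) < N, or H <= C and |G : C| >= 2; both give the bound.

   For the second part, a maximal system of imprimitivity is determined by the
   stabiliser of the block of a point x, which is a maximal subgroup over the
   stabiliser of x. *)

(** * Complements of a minimal normal subgroup that are normalised by G *)

Section Complements.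
Local Open Scope group_scope.

Lemma leq_card_fibers (T U : finType) (f : T -> U) (A : {set T}) (B : {set U})
    (k : nat) :
    {in A, forall x, f x \in B} ->
    {in B, forall y, #|[set x in A | f x == y]| <= k} ->
  (#|A| <= #|B| * k)%N.
Proof.
move=> fAB fib; rewrite -sum1_card (partition_big f (mem B)) //=.
rewrite -sum_nat_const; apply: leq_sum => y By.
by rewrite sum1dep_card; apply: fib.
Qed.

Variable gT : finGroupType.
Implicit Types G H K N A D L S W : {group gT}.

Lemma minnormal_TI_or_sub G N A :
  minnormal N G -> G \subset 'N(A) -> N :&: A = 1 \/ N \subset A.
Proof.
case/mingroupP=> /andP[ntN nNG] minN nAG.
have [NA1 | ntNA] := eqVneq (N :&: A) 1; [by left | right].
by apply/setIidPl; rewrite (minN _ _ (subsetIl N A)) // ntNA normsI.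
Qed.

Lemma compl_card N A D :
  D \in [complements to N in A] -> #|A| = (#|N| * #|D|)%N.
Proof. by case/complP=> TI <-; rewrite TI_cardMg. Qed.

Lemma compl_sub_eq N A D1 D2 :
    D1 \in [complements to N in A] -> D2 \in [complements to N in A] ->
  D1 \subset D2 -> D1 = D2.
Proof.
move=> c1 c2 sD; apply/val_inj/eqP; rewrite eqEcard sD /=.
by rewrite -(leq_pmul2l (cardG_gt0 N)) -(compl_card c1) -(compl_card c2).
Qed.

Lemma compl_setI N A D W :
    D \in [complements to N in A] -> N \subset W -> W \subset A ->
  (D :&: W)%G \in [complements to N in W].
Proof.
case/complP=> TI defA sNW sWA; apply/complP; split.
  by apply/trivgP; rewrite -TI /= setIA subsetIl.
by rewrite /= group_modl // defA; apply/setIidPr.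
Qed.

Definition norm_compls G S N A : {set {group gT}} :=
  [set D in [complements to N in A] | (G \subset 'N(D)) && (S \subset D)].

Lemma norm_complsP G S N A D :
  reflect [/\ D \in [complements to N in A], G \subset 'N(D) & S \subset D]
          (D \in norm_compls G S N A).
Proof. by rewrite /norm_compls [D \in [set _ in _ | _]]in_set; apply: and3P. Qed.

(** The product D1 D2 is normalised by G, so it contains N or meets N trivially. In the latter case
    it would itself be a complement, containing D1 and D2, and comparing orders would give D1 = D2.
    Hence it contains N D2 = A. *)
Lemma norm_compls_mul G S N A D1 D2 :
    minnormal N G -> A \subset G ->
    D1 \in norm_compls G S N A -> D2 \in norm_compls G S N A ->
  D1 != D2 -> D1 * D2 = A /\ #|D1| = (#|N| * #|D1 :&: D2|)%N.
Proof.
move=> minN sAG /norm_complsP[c1 n1 _] /norm_complsP[c2 n2 _] neqD.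
have /complP[TI1 def1] := c1; have /complP[TI2 def2] := c2.
have sD1A : D1 \subset A by rewrite -def1 mulG_subr.
have sD2A : D2 \subset A by rewrite -def2 mulG_subr.
have sNA : N \subset A by rewrite -def1 mulG_subl.
have n12 : D2 \subset 'N(D1) by apply: subset_trans n1; apply: subset_trans sAG.
have defA : D1 * D2 = A.
  rewrite -(norm_joinEr n12); apply/eqP; rewrite eqEsubset join_subG sD1A sD2A /=.
  have [TI | sN] := minnormal_TI_or_sub minN (normsY n1 n2).
    have c : (D1 <*> D2)%G \in [complements to N in A].
      apply/complP; split; first exact: TI.
      apply/eqP; rewrite eqEsubset.
      rewrite mul_subG ?join_subG ?sD1A //=.
      by rewrite -{1}def1 mulgS ?joing_subl.
    have e1 := compl_sub_eq c1 c (joing_subl _ _).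
    have e2 := compl_sub_eq c2 c (joing_subr _ _).
    by rewrite {1}e1 -e2 eqxx in neqD.
  by rewrite -{1}def2 mulG_subG sN joing_subr.
split=> //; have := mul_cardG D1 D2; rewrite defA (compl_card c2) mulnAC.
by move/eqP; rewrite eqn_pmul2r ?cardG_gt0 // => /eqP.
Qed.

(* Two distinct members D0 and D1 meet in a subgroup W of index |N| in D0, and
   D |-> D :&: N W maps into the members for N W.  If x lies in D0 but not in W,
   a member D of a fibre is determined by the n in N with n^-1 x in D, since
   distinct members of one fibre meet inside N W. *)
Lemma card_norm_compls G S N A :
    minnormal N G -> A \subset G ->
  (#|norm_compls G S N A| * (#|N| * #|S|) <= #|A|)%N.
Proof.
move=> minN; have [n] := ubnP #|A|; elim: n A => // n IHn A leA sAG.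
have [-> | [D0 DD0]] := set_0Vmem (norm_compls G S N A); first by rewrite cards0.
have /norm_complsP[c0 n0 sS0] := DD0.
(* If D0 is the only member, the bound reads |N| |S| <= |N| |D0| = |A|. *)
have [sub1 | ] := boolP (norm_compls G S N A \subset [set D0]).
  rewrite (compl_card c0) -[leqRHS]mul1n leq_mul ?leq_mul2l ?subset_leq_card ?orbT //.
  by rewrite -(cards1 D0) subset_leq_card.
case/subsetPn=> D1 DD1; rewrite inE eq_sym => neqD.
have /norm_complsP[c1 n1 sS1] := DD1.
have [defA card0] := norm_compls_mul minN sAG DD0 DD1 neqD.
have ntN : (1 < #|N|)%N.
  by rewrite cardG_gt1; case/mingroupP: minN => /andP[].
pose W := (D0 :&: D1)%G.
have nWG : G \subset 'N(W) by rewrite normsI.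
have sNG : N \subset G.
  by apply: subset_trans sAG; case/complP: c0 => _ <-; rewrite mulG_subl.
have nWN : N \subset 'N(W) by apply: subset_trans nWG.
pose B := (N <*> W)%G.
have defB : B = N * W :> {set gT} by rewrite /= joingC norm_joinEr // (normC nWN).
have sBA : B \subset A.
  rewrite defB; case/complP: c0 => _ <-; exact: mulgS (subsetIl _ _).
have sNB : N \subset B by rewrite joing_subl.
have TIW : N :&: W = 1.
  by apply/trivgP; case/complP: c0 => <- _; rewrite setIS ?subsetIl.
have cardB : #|B| = (#|N| * #|W|)%N by rewrite defB TI_cardMg.
have cardA : #|A| = (#|N| * #|B|)%N by rewrite (compl_card c0) card0 cardB.
have nBG : G \subset 'N(B) by case/mingroupP: minN => /andP[_ nNG] _; apply: normsY.
have ltBA : (#|B| < n)%N.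
  apply: leq_trans (_ : #|B| < #|A|)%N leA; by rewrite cardA ltn_Pmull.
have IH := IHn B ltBA (subset_trans sBA sAG).
have [x D0x W'x] : exists2 x, x \in D0 & x \notin W.
  apply/subsetPn; apply: contraTN ntN => /subset_leq_card.
  by rewrite card0 -[leqRHS]mul1n leq_pmul2r ?cardG_gt0 // -leqNgt.
(* As |A| = |N| |B|, the induction hypothesis for B leaves exactly a factor |N| for the size of a
   fibre. *)
suff le : (#|norm_compls G S N A| <= #|norm_compls G S N B| * #|N|)%N.
  apply: leq_trans (leq_mul le (leqnn _)) _.
  by rewrite cardA -mulnA mulnCA leq_mul2l IH orbT.
apply: (leq_card_fibers (f := fun D => (D :&: B)%G)) => [D | E].
  case/norm_complsP=> c nD sSD.
  apply/norm_complsP; split; [exact: compl_setI c _ _ | exact: normsI |].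
  by rewrite subsetI sSD (subset_trans _ (joing_subr _ _)) // subsetI sS0.
case/norm_complsP=> cE nE sSE.
have cardE : #|E| = #|W|.
  by apply/eqP; rewrite -(eqn_pmul2l (cardG_gt0 N)) -(compl_card cE) cardB.
have fP D : D \in norm_compls G S N A -> exists2 m, m \in N & m^-1 * x \in D.
  case/norm_complsP=> /complP[_ defA'] _ _.
  have /mulsgP[m d Nm Dd ->] : x \in N * D.
    by rewrite defA'; case/complP: c0 => _ <-; apply: subsetP D0x; rewrite mulG_subr.
  by exists m; rewrite // mulKg.
(* For a member [D] the [pick] succeeds by [fP], so the default 1 is never returned. *)
pose f D := odflt 1 [pick m in N | m^-1 * x \in D].
have fNP D : D \in norm_compls G S N A -> f D \in N /\ (f D)^-1 * x \in D.
  by rewrite /f => /fP[m Nm Dm]; case: pickP => [m' /andP[] | /(_ m)] //=; rewrite Nm Dm.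
rewrite -(@card_in_imset _ _ f); last first.
  move=> D D'; rewrite [D \in _]in_set [D' \in _]in_set.
  move=> /andP[DD /eqP defE] /andP[DD' /eqP defE'] eqf.
  apply/eqP; apply: contraNT W'x => neqDD.
  have [_ cardD] := norm_compls_mul minN sAG DD DD' neqDD.
  have [NfD fDx] := fNP D DD; have [_ fDx'] := fNP D' DD'.
  (* E lies in both D and D', and |D :&: D'| = |D| / |N| = |D0| / |N| = |W| = |E|. *)
  have eqE : E = D :&: D' :> {set gT}.
    apply/eqP; rewrite eqEcard subsetI -{1}defE -{1}defE' !subsetIl /=.
    have /norm_complsP[cDD _ _] := DD.
    rewrite cardE -2!(leq_pmul2l (cardG_gt0 N)) -cardD -(compl_card cDD).
    by rewrite (compl_card c0) card0.
  have Ex : (f D)^-1 * x \in E by rewrite eqE inE fDx eqf fDx'.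
  have Bx : x \in B.
    rewrite -(mulKVg (f D) x) groupM //; first exact: (subsetP sNB).
    by apply: subsetP Ex; case/complP: cE => _ <-; rewrite mulG_subr.
  have: x \in D0 :&: B by rewrite inE D0x.
  suff -> : D0 :&: B = W by [].
  have cW : W \in [complements to N in B] by apply/complP.
  have cDB := compl_setI c0 sNB sBA.
  apply/esym/(congr1 val)/(compl_sub_eq cW cDB).
  by rewrite subsetI subsetIl joing_subr.
apply/subset_leq_card/subsetP=> m /imsetP[D]; rewrite in_set => /andP[DD _] ->.
by case: (fNP D DD).
Qed.

(** * Conjugacy of complements with the same intersection with the centraliser of N *)

Lemma compl_subcent G N K :
    abelian N -> N <| G -> K \in [complements to N in G] ->
  (K :&: 'C_G(N))%G \in norm_compls G 1%G N 'C_G(N).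
Proof.
move=> abN nsNG cK; have /complP[TI defG] := cK.
have sKG : K \subset G by rewrite -defG mulG_subr.
apply/norm_complsP; split; last exact: sub1G.
  by apply: compl_setI cK _ _; rewrite ?subsetIl // subsetI normal_sub.
(* G = N K, where N centralises K :&: C_G(N) and K normalises both factors of the intersection. *)
rewrite -{1}defG mulG_subG; apply/andP; split.
  by rewrite cents_norm // centsC /= setIA subsetIr.
rewrite normsI ?normG // (subset_trans sKG) //.
by rewrite normsI ?normG // norms_cent ?normal_norm.
Qed.

(** For a Sylow p-subgroup P of L one has L = C_G(N) P. The p-group N P has a centre meeting N
    nontrivially, and this intersection is centralised by C_G(N) and by P, hence by L. So N :&: C(L)
    is nontrivial and normalised by G, and minimality makes it N. *)
Lemma pquotient_cent_minnormal (p : nat) G N L :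
    minnormal N G -> N \subset G -> p.-group N ->
    'C_G(N) \subset L -> L <| G -> p.-group (L / 'C_G(N)) ->
  L \subset 'C(N).
Proof.
move=> minN sNG pN sCL nsLG pLC; have [sLG nLG] := andP nsLG.
have [/andP[ntN nNG] _] := mingroupP minN.
have [P sylP] := Sylow_exists p L; have [sPL pP _] := and3P sylP.
have nPN : P \subset 'N(N) by rewrite (subset_trans sPL) ?(subset_trans sLG).
have nCL : L \subset 'N('C_G(N)).
  by rewrite (subset_trans sLG) // normsI ?normG // norms_cent.
have sLCP : L \subset 'C_G(N) * P.
  rewrite -quotientSK //.
  by rewrite (pHall_id (quotient_pHall (subset_trans sPL nCL) sylP) pLC).
have pNP : p.-group (N <*> P) by rewrite norm_joinEr // pgroupM pN.
have nsN : N <| N <*> P by rewrite /normal joing_subl join_subG normG.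
have ntZ := meet_center_nil (pgroup_nil pNP) nsN ntN.
have [TI | ] := minnormal_TI_or_sub minN (norms_cent nLG); last by rewrite centsC.
case/negP: ntZ; rewrite -subG1 -TI subsetI subsetIl centsC (subset_trans sLCP) //.
have sNPP : P \subset N <*> P by rewrite joing_subr.
rewrite mulG_subG; apply/andP; split.
  by rewrite centsC (subset_trans (subsetIl _ _)) // centsC subsetIr.
by rewrite centsC (subset_trans (subsetIr _ _)) // subIset // (centS sNPP) orbT.
Qed.

(** Conjugacy of the Hall subgroups (Ki :&: L) / D lifts to K1 and K2 because each Ki contains the
    normaliser in G of Ki :&: L. *)
Lemma compl_conj_subcent G N K1 K2 :
    solvable G -> minnormal N G -> N \subset G -> ~~ (G \subset 'C(N)) ->
    K1 \in [complements to N in G] -> K2 \in [complements to N in G] ->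
    K1 :&: 'C_G(N) = K2 :&: 'C_G(N) ->
  exists2 n, n \in N & K2 = K1 :^ n :> {set gT}.
Proof.
move=> solG minN sNG ncGN c1 c2 eqD.
have [nNG ntN abN] := minnormal_solvable minN sNG solG.
have [p p_pr abelN] := is_abelemP abN.
have [pN cNN _] := and3P abelN.
have nsNG : N <| G by apply/andP.
have nsCG : 'C_G(N) <| G.
  by rewrite /normal subsetIl normsI ?normG // norms_cent.
have ntGC : G / 'C_G(N) != 1.
  rewrite -subG1 quotient_sub1 ?normal_norm //.
  by apply: contra ncGN => /subset_trans-> //; rewrite subsetIr.
have [Lb minLb sLb] := minnormal_exists ntGC (normG _).
have [nLb ntLb /is_abelemP[q q_pr abelLb]] :=
  minnormal_solvable minLb sLb (quotient_sol _ solG).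
have nsLb : Lb <| G / 'C_G(N) by apply/andP.
have [L defLb sCL nsLG] := inv_quotientN nsCG nsLb.
have nLcN : ~~ (L \subset 'C(N)).
  apply: contra ntLb => cLN; rewrite defLb -subG1 quotient_sub1.
    by rewrite subsetI cLN normal_sub.
  by rewrite (subset_trans (normal_sub nsLG)) ?normal_norm.
have qLC : q.-group (L / 'C_G(N)) by rewrite -defLb abelem_pgroup.
have neq_qp : q != p.
  apply: contra nLcN => /eqP eqqp; rewrite eqqp in qLC.
  exact: pquotient_cent_minnormal minN sNG pN sCL nsLG qLC.
pose D := (K1 :&: 'C_G(N))%G.
have /norm_complsP[cD nDG _] := compl_subcent cNN nsNG c1.
have sLG := normal_sub nsLG.
have nDL : L \subset 'N(D) by apply: subset_trans nDG.
have sNL : N \subset L by apply: subset_trans sCL; rewrite subsetI sNG.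
have hall K : K \in [complements to N in G] -> K :&: 'C_G(N) = D ->
   [/\ (K :&: L)%G \in [complements to N in L], D \subset K :&: L
     & p^'.-Hall(L / D) ((K :&: L) / D)].
  move=> cK defD; have cKL := compl_setI cK sNL sLG.
  have sDKL : D \subset K :&: L by rewrite -defD setIS.
  split=> //; have nDKL : K :&: L \subset 'N(D) by rewrite subIset // nDL orbT.
  (* The order of (K :&: L) / D is (|L| / |N|) / (|C_G(N)| / |N|) = |L : C_G(N)|, a power of q, and
     its index in L / D is |N|, a power of p. *)
  rewrite /pHall quotientS ?subsetIr //= /pgroup; apply/andP; split.
    have -> : #|(K :&: L) / D| = #|L / 'C_G(N)|.
      rewrite !card_quotient ?(subset_trans sLG (normal_norm nsCG)) //.
      rewrite -!divgS //= (compl_card cKL) (compl_card cD).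
      by rewrite divnMl ?cardG_gt0.
    by apply: pi_pnat qLC _; rewrite !inE.
  rewrite index_quotient_eq ?subsetIr //; last by rewrite subIset // sDKL orbT.
  rewrite -divgS ?subsetIr // (compl_card cKL) mulnK ?cardG_gt0 // pnatNK.
  exact: pN.
have [cJ1 sDJ1 hall1] := hall K1 c1 erefl.
have [cJ2 sDJ2 hall2] := hall K2 c2 (esym eqD).
have [xb Lxb eqJb] := Hall_trans (quotient_sol _ (solvableS sLG solG)) hall2 hall1.
have /morphimP[x nDx Lx def_xb] := Lxb.
have eqJ : K2 :&: L = (K1 :&: L) :^ x.
  apply: (@quotient_inj _ D (K2 :&: L) ((K1 :&: L) :^ x)).
  - by rewrite /normal sDJ2 subIset // nDL orbT.
  - rewrite /normal /= -{1}(normP nDx) conjSg sDJ1 /=.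
    by rewrite (subset_trans _ nDL) // sub_conjg conjGid ?groupV ?subsetIr.
  - by rewrite quotientJ // -def_xb.
have [n Nn eqJn] : exists2 n, n \in N & K2 :&: L = (K1 :&: L) :^ n.
  have: x \in (K1 :&: L) * N.
    rewrite (normC (_ : _ \subset 'N(N))); first by case/complP: cJ1 => _ ->.
    by rewrite subIset // (subset_trans sLG) ?orbT.
  by case/mulsgP=> j n J1j Nn def_x; exists n; rewrite // eqJ def_x conjsgM (conjGid J1j).
(* The part of N normalising K :&: L is normalised by the abelian N and by K, so it is 1 or N. If it
   is 1, Dedekind's law puts the normaliser inside K. If it is N, then [N, K :&: L] lies in N :&: K
   = 1 and L would centralise N. *)
have selfN K : K \in [complements to N in G] -> 'N_G(K :&: L) \subset K.
  move=> cK; have /complP[TIK defG] := cK; have /complP[TIJ defL] := compl_setI cK sNL sLG.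
  have sKG : K \subset G by rewrite -defG mulG_subr.
  have sKX : K \subset 'N_G(K :&: L).
    by rewrite subsetI sKG normsI ?normG // (subset_trans sKG) ?normal_norm.
  have nXG : G \subset 'N(N :&: 'N_G(K :&: L)).
    rewrite -{1}defG mulG_subG; apply/andP; split.
      by rewrite cents_norm // (sub_abelian_cent cNN) ?subsetIl.
    by rewrite normsI ?(subset_trans sKG nNG) // (subset_trans sKX) ?normG.
  have [] := minnormal_TI_or_sub minN nXG.
    rewrite setIA setIid => TIX.
    apply: subset_trans (_ : _ \subset K * (N :&: 'N_G(K :&: L))) _; last by rewrite TIX mulg1.
    rewrite group_modl //.
    by rewrite (normC (subset_trans sKG nNG)) defG subsetI subxx subsetIl.
  rewrite subsetI subxx subsetI sNG /= => nJN.
  case/negP: nLcN; rewrite -defL mulG_subG; apply/andP; split=> //; apply/commG1P/trivgP.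
  rewrite -TIJ /= commGC commg_subI // subsetI subxx ?nJN //.
  by rewrite subIset // (subset_trans sLG) ?orbT.
exists n => //; apply/eqP; rewrite eq_sym eqEcard; apply/andP; split.
  apply: subset_trans (selfN K2 c2); rewrite eqJn subsetI normJ conjSg.
  have sK1G : K1 \subset G by case/complP: c1 => _ <-; rewrite mulG_subr.
  rewrite conj_subG ?(subsetP sNG) //= normsI ?normG //.
  by rewrite (subset_trans sK1G) ?normal_norm.
rewrite cardJg -(leq_pmul2l (cardG_gt0 N)).
by rewrite -(compl_card c1) -(compl_card c2).
Qed.

(** This is the bound |G : NH| (|N| - 1) with denominators cleared: a complement containing H forces
    N :&: H = 1, so |NH| = |N| |H|. *)
Lemma card_compl_over G N H :
    solvable G -> minnormal N G -> N \subset G ->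
  (#|[set K in [complements to N in G] | H \subset K]| * (#|N| * #|H|)
    <= #|G| * #|N|.-1)%N.
Proof.
move=> solG minN sNG; set X := [set K in _ | _].
have XP K : reflect (K \in [complements to N in G] /\ H \subset K) (K \in X).
  by rewrite /X [K \in [set _ in _ | _]]in_set; apply: andP.
have [-> | [K0 /XP[c0 sHK0]]] := set_0Vmem X; first by rewrite cards0.
have [nNG ntN /is_abelemP[p _ /and3P[_ cNN _]]] := minnormal_solvable minN sNG solG.
have nsNG : N <| G by apply/andP.
have sHG : H \subset G.
  by apply: subset_trans sHK0 _; case/complP: c0 => _ <-; rewrite mulG_subr.
have N_gt1 : (1 < #|N|)%N by rewrite cardG_gt1.
(* When N is central every complement K is normal in G = N K, so [card_norm_compls] applies with A =
   G; also |N| - 1 >= 1. *)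
have [cGN | ncGN] := boolP (G \subset 'C(N)).
  apply: leq_trans (_ : _ <= #|G|)%N _; last first.
    by rewrite leq_pmulr // -subn1 subn_gt0.
  apply: leq_trans (card_norm_compls H minN (subxx G)).
  rewrite leq_mul2r subset_leq_card ?orbT //; apply/subsetP=> K /XP[cK sHK].
  apply/norm_complsP; split=> //; have /complP[_ {1}<-] := cK.
  rewrite mulG_subG normG andbT cents_norm // centsC.
  by apply: subset_trans cGN; case/complP: cK => _ <-; rewrite mulG_subr.
have fib : (#|X| <= #|norm_compls G (H :&: 'C_G(N)) N 'C_G(N)| * #|'C_N(H)|)%N.
  apply: (leq_card_fibers (f := fun K => (K :&: 'C_G(N))%G)) => [K /XP[cK sHK] | D _].
    have /norm_complsP[cD nDG _] := compl_subcent cNN nsNG cK.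
    by apply/norm_complsP; split; rewrite // setSI.
  set Y := [set _ in _ | _].
  have YP K : K \in Y -> K \in X /\ K :&: 'C_G(N) = D.
    by rewrite in_set => /andP[-> /eqP <-].
  have [-> | [K1 /YP[/XP[c1 sHK1] defD]]] := set_0Vmem Y; first by rewrite cards0.
  suff sY : Y \subset [set (K1 :^ n)%G | n in 'C_N(H)].
    exact: leq_trans (subset_leq_card sY) (leq_imset_card _ _).
  apply/subsetP=> K /YP[/XP[cK sHK] defDK].
  have [n Nn defK] := compl_conj_subcent solG minN sNG ncGN c1 cK (etrans defD (esym defDK)).
  apply/imsetP; exists n; last exact: val_inj.
  (* For h in H, both h and its conjugate by n^-1 lie in K1, so [h, n^-1] lies in N :&: K1 = 1. *)
  rewrite inE Nn /=; apply/centP=> h Hh; rewrite -[n]invgK.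
  apply/commute_sym/commuteV/commgP; rewrite -in_set1 -set1gE.
  have /complP[<- _] := c1; rewrite inE; apply/andP; split.
    rewrite commgEr groupMr ?groupV // memJ_norm ?groupV //.
    by rewrite (subsetP nNG) ?(subsetP sHG).
  rewrite commgEl groupMl; last by rewrite groupV (subsetP sHK1).
  by rewrite -mem_conjg -defK (subsetP sHK).
(* Put C = C_G(N) and I = H :&: C. Multiplying by |I| and using |C| |H| = |CH| |I| reduces this to
   [fib] and the bound |C| of [card_norm_compls] with S = I. *)
have le1 : (#|X| * (#|N| * #|H|) <= #|('C_G(N) * H)%g| * #|'C_N(H)|)%N.
  pose I := (H :&: 'C_G(N))%G.
  have eqI : #|'C_G(N) :&: H| = #|I| by rewrite setIC.
  rewrite -(leq_pmul2r (cardG_gt0 I)) [leqRHS]mulnAC -eqI -mul_cardG eqI.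
  have leC := card_norm_compls I minN (subsetIl G 'C(N)).
  apply: leq_trans (leq_mul (leq_mul fib (leqnn _)) (leqnn _)) _.
  have mulACA f c n h i : (f * c * (n * h) * i = f * (n * i) * (h * c))%N.
    by clear; lia.
  by rewrite mulACA -[leqRHS]mulnA leq_mul.
(* If N centralises H, then CH = C has index at least 2 in G, and |N| <= 2 (|N| - 1). Otherwise
   C_N(H) is proper in N, so its order is at most |N| - 1. *)
have [sNCH | nsNCH] := boolP (N \subset 'C_N(H)).
  have sHC : H \subset 'C_G(N).
    by rewrite subsetI sHG centsC (subset_trans sNCH) ?subsetIr.
  apply: leq_trans le1 _; rewrite mulGSid //.
  have prC : 'C_G(N) \proper G.
    by rewrite properE subsetIl; apply: contra ncGN; rewrite subsetI => /andP[].
  rewrite -(Lagrange (proper_sub prC)) -mulnA leq_mul //.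
  have := proper_subn prC; rewrite -indexg_gt1 => gt1.
  have leN := subset_leq_card (subsetIl N 'C(H)).
  apply: leq_trans leN _; apply: leq_trans (leq_mul gt1 (leqnn _)).
  have le_doublep n : (1 < n -> n <= 2 * n.-1)%N by clear; lia.
  exact: le_doublep.
apply: leq_trans le1 _; rewrite leq_mul //.
  by rewrite subset_leq_card // mul_subG ?subsetIl.
rewrite -ltnS prednK ?cardG_gt0 // proper_card // properEneq subsetIl andbT.
by apply: contraNneq nsNCH => ->.
Qed.
End Complements.

(** * Counting maximal subgroups over H *)

Section MaximalOvergroups.
Local Open Scope group_scope.

Lemma maximal_group (gT : finGroupType) (M G : {set gT}) :
  maximal M G -> exists K : {group gT}, M = K.
Proof. by case/maxsetp/andP=> gM _; exists (Group gM). Qed.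

(** Maximality of K gives N K = G. Then N :&: K is normalised by K and by the abelian N, hence by G,
    and it is not N, so it is trivial. *)
Lemma maximal_minnormal_compl (gT : finGroupType) (G N K : {group gT}) :
    solvable G -> minnormal N G -> N \subset G -> maximal K G ->
  ~~ (N \subset K) -> K \in [complements to N in G].
Proof.
move=> solG minN sNG /maxgroupP[prK maxK] nsNK.
have [nNG _ /is_abelemP[p _ /and3P[_ cNN _]]] := minnormal_solvable minN sNG solG.
have sKG := proper_sub prK; have nNK := subset_trans sKG nNG.
have defG : N * K = G.
  rewrite -norm_joinEr //; apply: contraNeq nsNK => neqG.
  rewrite -(maxK (N <*> K)%G) ?joing_subl ?joing_subr //.
  by rewrite properEneq neqG join_subG sNG.
apply/complP; split=> //.
have nIG : G \subset 'N(N :&: K).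
  rewrite -{1}defG mulG_subG; apply/andP; split; last by rewrite normsI ?normG.
  by rewrite cents_norm // (sub_abelian_cent cNN) ?subsetIl.
have [] := minnormal_TI_or_sub minN nIG; first by rewrite setIA setIid.
by rewrite subsetI (negPf nsNK) andbF.
Qed.

Lemma card_max_over (gT : finGroupType) (G H : {group gT}) :
    solvable G -> H \proper G -> (#|max_over H G| <= #|G : H| - 1)%N.
Proof.
have [n] := ubnP #|G|; elim: n gT G H => // n IHn gT G H leG solG prHG.
have sHG := proper_sub prHG.
have ntG : G :!=: 1.
  by apply: contraTneq prHG => ->; rewrite properE sub1G andbF.
have [N minN sNG] := minnormal_exists ntG (normG G).
have [nNG ntN _] := minnormal_solvable minN sNG solG.
have nsNG : N <| G by apply/andP.
have nNH := subset_trans sHG nNG.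
rewrite -(cardsID [set M : {set gT} | N \subset M] (max_over H G)).
set X := _ :&: _; set Y := _ :\: _.
have leX : (#|X| <= #|G : N <*> H| - 1)%N.
  have XP M : M \in X ->
      exists K : {group gT}, [/\ M = K, maximal K G, H \subset K & N \subset K].
    rewrite !inE => /andP[/andP[maxM sHM] sNM].
    by have [K defM] := maximal_group maxM; exists K; rewrite -defM.
  (* When NH = G the induction hypothesis does not apply to H / N, but no maximal subgroup contains
     NH and the bound is 0. *)
  have [sGNH | nsGNH] := boolP (G \subset N <*> H).
    rewrite (_ : X = set0) ?cards0 //; apply/setP=> M; rewrite [RHS]inE.
    apply/negP=> /XP[K [_ /maxgroupp/proper_subn/negP nsGK sHK sNK]]; case: nsGK.
    by rewrite (subset_trans sGNH) // join_subG sNK.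
  have prHb : H / N \proper G / N.
    rewrite properE quotientS //=; apply: contra nsGNH.
    by rewrite quotientSK // norm_joinEr.
  have ltGb : (#|G / N| < n)%N by apply: leq_trans (ltn_quotient ntN sNG) _.
  have -> : #|G : N <*> H| = #|G / N : H / N|.
    rewrite -(quotientYidl nNH) index_quotient_eq ?join_subG ?sNG //.
    by rewrite subIset // joing_subl orbT.
  apply: leq_trans (IHn _ _ _ ltGb (quotient_sol _ solG) prHb).
  have nsN (K : {group gT}) : maximal K G -> N \subset K -> N <| K.
    move=> maxK sNK; rewrite /normal sNK (subset_trans _ nNG) //.
    by have /maxgroupp/proper_sub := maxK.
  rewrite -(@card_in_imset _ _ (fun M => M / N)); last first.
    move=> M1 M2 /XP[K1 [-> max1 _ s1]] /XP[K2 [-> max2 _ s2]] /= eqK.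
    by apply: quotient_inj eqK; apply: nsN.
  apply/subset_leq_card/subsetP=> _ /imsetP[M /XP[K [-> maxK sHK sNK]] ->].
  by rewrite inE quotientS // andbT quotient_maximal // nsN.
have leY := card_compl_over H solG minN sNG.
set Z := [set K in _ | _] in leY.
have sYZ : Y \subset [set gval K | K in Z].
  apply/subsetP=> M; rewrite !inE => /and3P[nsNM maxM sHM].
  have [K defM] := maximal_group maxM; rewrite defM in nsNM maxM sHM *.
  apply: imset_f; rewrite [K \in Z]in_set sHM andbT.
  exact: maximal_minnormal_compl.
have leYZ := leq_trans (subset_leq_card sYZ) (leq_imset_card _ _).
have [Z0 | [K]] := set_0Vmem Z.
  have /eqP -> : #|Y| == 0%N by rewrite -leqn0 -(cards0 {group gT}) -Z0.
  rewrite addn0 (leq_trans leX) // leq_sub2r // dvdn_leq //.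
  by rewrite indexgS ?joing_subr.
rewrite [K \in Z]in_set => /andP[/complP[TI _] sHK].
have cardNH : #|N <*> H| = (#|N| * #|H|)%N.
  by rewrite norm_joinEr // TI_cardMg //; apply/trivgP; rewrite -TI setIS.
have sNHG : N <*> H \subset G by rewrite join_subG sNG.
have cG := Lagrange sNHG; have cGH := Lagrange sHG.
have idxE : #|G : H| = (#|N| * #|G : N <*> H|)%N.
  apply/eqP; rewrite -(eqn_pmul2l (cardG_gt0 H)) cGH -cG cardNH.
  by rewrite -mulnA mulnCA eqxx.
have leZ : (#|Z| <= #|G : N <*> H| * #|N|.-1)%N.
  rewrite -(leq_pmul2r (cardG_gt0 (N <*> H))) cardNH.
  apply: leq_trans leY _.
  by rewrite -cG cardNH -[leqLHS]mulnA [leqLHS]mulnC.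
(* With m = |G : NH| and k = |N|, the two counts add up to (m - 1) + m (k - 1) = k m - 1, and k m =
   |G : H|. *)
have finish x y m k : (0 < k -> 0 < m -> x <= m - 1 -> y <= m * k.-1 -> x + y <= k * m - 1)%N.
  by clear; case: k => // k _ m0; rewrite mulSn /= mulnC; lia.
rewrite idxE; apply: finish leX (leq_trans leYZ leZ); rewrite ?cardG_gt0 //.
Qed.
End MaximalOvergroups.

(** * Invariant partitions and block stabilisers *)

Section BlockStabilisers.
Local Open Scope group_scope.
Variables (T : finType) (G : {group {perm T}}).
Hypothesis transG : [transitive G, on [set: T] | 'P].
Implicit Types (P : {set {set T}}) (L : {group {perm T}}) (x y z : T).

Lemma trans_perm x y : exists2 g, g \in G & y = g x.
Proof. by have [g Gg ->] := atransP2 transG (in_setT x) (in_setT y); exists g. Qed.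

Lemma mem_inv_pblock P x : inv_partition G P -> x \in pblock P x.
Proof. by case/andP=> /and3P[/eqP cov _ _] _; rewrite mem_pblock cov inE. Qed.

Lemma inv_pblock_mem P x : inv_partition G P -> pblock P x \in P.
Proof. by case/andP=> /and3P[/eqP cov _ _] _; rewrite pblock_mem ?cov ?inE. Qed.

Lemma inv_pblock_eq P C x : inv_partition G P -> C \in P -> x \in C -> pblock P x = C.
Proof. by case/andP=> /and3P[_ tI _] _; apply: def_pblock. Qed.

Lemma inv_pblock_perm P g x :
  inv_partition G P -> g \in G -> pblock P (g x) = [set g y | y in pblock P x].
Proof.
move=> invP Gg; have /andP[_ /forall_inP/(_ g Gg)/forall_inP invg] := invP.
apply: (inv_pblock_eq invP); first exact/invg/inv_pblock_mem.
by rewrite imset_f ?mem_inv_pblock.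
Qed.

Lemma inv_partitionE P : inv_partition G P -> P = [set pblock P y | y : T].
Proof.
move=> invP; apply/setP=> C; apply/idP/imsetP=> [PC | [y _ ->]]; last first.
  exact: inv_pblock_mem.
have /andP[/and3P[_ _ P0] _] := invP.
have [C0 | [y Cy]] := set_0Vmem C; first by rewrite -C0 PC in P0.
by exists y; rewrite // (inv_pblock_eq invP PC).
Qed.

Definition block_stab P x : {group {perm T}} := 'N_G(pblock P x | 'P)%G.

Lemma block_stabP P x g : inv_partition G P ->
  reflect (g \in G /\ g x \in pblock P x) (g \in block_stab P x).
Proof.
move=> invP; apply: (iffP setIP) => -[Gg].
  by move/astabsP/(_ x); rewrite /= apermE mem_inv_pblock.
move=> Bgx; split=> //; rewrite /= -(astab1_set 'P); apply/astab1P.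
rewrite /= /setact -(inv_pblock_perm x invP Gg).
by apply: inv_pblock_eq; rewrite ?inv_pblock_mem.
Qed.

Lemma pblock_block_stab P x :
  inv_partition G P -> pblock P x = [set g x | g : {perm T} in block_stab P x].
Proof.
move=> invP; apply/setP=> y; apply/idP/imsetP=> [By | [g /(block_stabP x _ invP)[_ ? ->] //]].
have [g Gg def_y] := trans_perm x y.
by exists g => //; apply/block_stabP; rewrite // -def_y.
Qed.

(** The block of x is the orbit of x under its stabiliser, and by transitivity the other blocks are
    its translates. *)
Lemma block_stab_inj P1 P2 x :
    inv_partition G P1 -> inv_partition G P2 ->
  block_stab P1 x = block_stab P2 x -> P1 = P2.
Proof.
move=> inv1 inv2 eqM; rewrite (inv_partitionE inv1) (inv_partitionE inv2).
apply: eq_imset => y; have [g Gg ->] := trans_perm x y.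
by rewrite !inv_pblock_perm // !(pblock_block_stab x) // eqM.
Qed.

Lemma stab_sub_block_stab P x : inv_partition G P -> 'C_G[x | 'P] \subset block_stab P x.
Proof.
move=> invP; apply/subsetP=> g /setIP[Gg /astab1P /= gx]; apply/block_stabP => //.
by rewrite apermE in gx; rewrite gx mem_inv_pblock.
Qed.

(* [L * amove 'P G x y] is the coset [L g] for any [g] in [G] moving [x] to [y],
   so the blocks below are the sets [x L g]. *)
Definition coset_system L x : {set {set T}} :=
  preim_partition (fun y => L * amove 'P G x y) [set: T].

Lemma coset_label L x g :
  'C_G[x | 'P] \subset L -> g \in G -> L * amove 'P G x (g x) = L :* g.
Proof.
move=> sHL Gg; rewrite -[g x]apermE (amove_act 'P) ?subsetT //.
by rewrite mulgA mulGSid.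
Qed.

Lemma coset_systemP L x C :
  reflect (exists y, C = [set z | L * amove 'P G x y == L * amove 'P G x z])
          (C \in coset_system L x).
Proof.
apply: (iffP imsetP) => [[y _ ->] | [y ->]]; exists y => //;
  by apply/setP=> z; rewrite !inE.
Qed.

Lemma coset_system_inv L x :
  'C_G[x | 'P] \subset L -> inv_partition G (coset_system L x).
Proof.
move=> sHL; rewrite /inv_partition preim_partitionP /=.
apply/forall_inP=> g Gg; apply/forall_inP=> _ /coset_systemP[y ->].
apply/coset_systemP; exists (g y); apply/setP=> z.
have [h Gh ->] := trans_perm x y; have [k Gk ->] := trans_perm x z.
(* The label of g (u x) is that of u x multiplied by g on the right, so g preserves equality of
   labels. *)
have labg u : u \in G -> L * amove 'P G x (g (u x)) = L :* (u * g).
  by move=> Gu; rewrite -permM coset_label ?groupM.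
rewrite inE labg // (coset_label sHL Gk).
apply/imsetP/eqP=> [[t] | eqL].
  have [u Gu ->] := trans_perm x t; rewrite inE !coset_label // => /eqP eqL eqk.
  by rewrite !rcosetM eqL -rcosetM -labg // -eqk coset_label.
exists (g^-1 (k x)); last by rewrite permKV.
rewrite inE -permM !coset_label ?groupM ?groupV //.
by rewrite rcosetM -eqL rcosetM rcosetK.
Qed.

(** A proper subgroup L of G containing the block stabiliser yields an invariant partition, coarser
    than P and not the one-block partition. Maximality of P makes the two equal, so the block of x
    is its L-orbit and L stabilises it. *)
Lemma block_stab_maximal P x : max_system G P -> maximal (block_stab P x) G.
Proof.
case/and3P=> invP ntP /forallP maxP; apply/maxgroupP; split.
  rewrite properE subsetIl; apply: contra ntP => sGM; rewrite /trivial_partition.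
  have BT y : pblock P y = setT.
    have xB z : z \in pblock P x.
      have [g Gg ->] := trans_perm x z.
      by have /(block_stabP x g invP)[] := subsetP sGM g Gg.
    apply/setP=> z; rewrite (inv_pblock_eq invP (inv_pblock_mem x invP) (xB y)).
    by rewrite xB inE.
  apply/orP; right; apply/eqP/setP=> C; rewrite (inv_partitionE invP) inE.
  apply/imsetP/eqP => [[y _ ->] // | ->]; by exists x; rewrite ?BT.
move=> L prL sML; apply/eqP; rewrite eqEsubset sML andbT.
have sHL := subset_trans (stab_sub_block_stab x invP) sML.
have sLG := proper_sub prL.
pose C := [set z | L * amove 'P G x x == L * amove 'P G x z].
have Cx : L * amove 'P G x x = L.
  by rewrite -{2}[x](perm1 x) coset_label // rcoset1.
have invQ := coset_system_inv sHL.
have := maxP (coset_system L x); rewrite invQ /=.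
have -> : coset_system L x != [set [set: T]].
  apply: contraTneq prL => defQ; rewrite properE sLG negbK.
  apply/subsetP=> g Gg.
  have /set1P/setP/(_ (g x)) : C \in [set [set: T]].
    by rewrite -defQ; apply/coset_systemP; exists x.
  by rewrite !inE Cx coset_label // => /eqP->; rewrite rcoset_refl.
have -> : refines P (coset_system L x).
  apply/forall_inP=> B; rewrite (inv_partitionE invP) => /imsetP[y _ ->{B}].
  apply/exists_inP; eexists; first by apply/coset_systemP; exists y.
  have [g Gg ->] := trans_perm x y; rewrite inv_pblock_perm //.
  apply/subsetP=> _ /imsetP[t + ->]; rewrite pblock_block_stab // => /imsetP[m Mm ->].
  have Lm := subsetP sML m Mm; have Gm := subsetP sLG m Lm.
  by rewrite inE -permM !coset_label ?groupM // rcosetM (rcoset_id Lm) eqxx.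
move/eqP=> defP; apply/subsetP=> l Ll; have Gl := subsetP sLG l Ll.
apply/block_stabP => //; split=> //.
have PC : C \in P by rewrite -defP; apply/coset_systemP; exists x.
rewrite (inv_pblock_eq invP PC) ?inE ?eqxx //.
by rewrite Cx coset_label // rcoset_id ?eqxx.
Qed.
End BlockStabilisers.

Lemma card_max_system (T : finType) (G : {group {perm T}}) :
  solvable G -> 2 <= #|T| -> [transitive G, on [set: T] | 'P] ->
  #|[set P : {set {set T}} | max_system G P]| <= #|T| - 1.
Proof.
move=> solG T_gt1 transG.
have [x _] : exists x : T, x \in T by apply/card_gt0P; apply: ltnW.
have cardT : #|T| = #|G : 'C_G[x | 'P]|%g.
  by rewrite -card_orbit (atransP transG) ?inE // cardsT.
have prH : 'C_G[x | 'P]%g \proper G.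
  by rewrite properE subsetIl -indexg_gt1 -cardT.
rewrite cardT; apply: leq_trans (card_max_over solG prH).
rewrite -(@card_in_imset _ _ (fun P => gval (block_stab G P x))) => [|P1 P2].
  apply/subset_leq_card/subsetP=> _ /imsetP[P + ->]; rewrite !inE => maxP.
  rewrite block_stab_maximal // stab_sub_block_stab //.
  by case/and3P: maxP.
rewrite !inE => /and3P[inv1 _ _] /and3P[inv2 _ _] /val_inj.
exact: block_stab_inj.
Qed.

Theorem theorem1p2 :
  (forall (gT : finGroupType) (G H : {group gT}),
      solvable G -> H \proper G ->
      #|max_over H G| <= #|G : H|%g - 1)
  /\
  (forall (T : finType) (G : {group {perm T}}),
      solvable G -> 2 <= #|T| -> [transitive G, on [set: T] | 'P] ->
      #|[set P : {set {set T}} | max_system G P]| <= #|T| - 1).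
Proof. by split; [exact: card_max_over | exact: card_max_system]. Qed.
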